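(* Let $0<p<1$, let $L(n)$ be the length of the longest success run in the first $n$ of a sequence of i.i.d. Bernoulli($p$) trials, and write $\ell(n)=\log_{1/p} n$. (I) Let $f:\mathbb{R}_+\to\mathbb{R}$ be continuous and satisfy at least one of the two conditions $$\text{(a)}\quad \lim_{m\to\infty}\limsup_{n\to\infty}\frac{1}{\ell(n)}\ln\mathbb{E}\left[\exp\left\{\ell(n)\, f\!\left(\tfrac{L(n)}{\ell(n)}\right)\right\}\mathbf{1}_{\left\{f\left(L(n)/\ell(n)\right)\ge m\right\}}\right]=-\infty,$$ $$\text{(b)}\quad \limsup_{n\to\infty}\frac{1}{\ell(n)}\ln\mathbb{E}\exp\left\{\gamma\,\ell(n)\, f\!\left(\tfrac{L(n)}{\ell(n)}\right)\right\}<\infty\quad\text{for some }\gamma>1.$$ Then $$\lim_{n\to\infty}\frac{1}{\ell(n)}\ln\mathbb{E}\exp\left\{\ell(n)\, f\!\left(\tfrac{L(n)}{\ell(n)}\right)\right\}=\max_{x\in\mathbb{R}}\,[f(x)-\Lambda^*(x)].$$ (II) Let $g:\mathbb{R}_+\to\mathbb{R}$ be continuous and satisfy at least one of the two conditions $$\text{(c)}\quad \lim_{m\to\infty}\limsup_{n\to\infty}\frac{1}{n}\ln\mathbb{E}\left[\exp\left\{n\, g\!\left(\tfrac{L(n)}{n}\right)\right\}\mathbf{1}_{\left\{g\left(L(n)/n\right)\ge m\right\}}\right]=-\infty,$$ $$\text{(d)}\quad \limsup_{n\to\infty}\frac{1}{n}\ln\mathbb{E}\exp\left\{\gamma\, n\,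 g\!\left(\tfrac{L(n)}{n}\right)\right\}<\infty\quad\text{for some }\gamma>1.$$ Then $$\lim_{n\to\infty}\frac{1}{n}\ln\mathbb{E}\exp\left\{n\, g\!\left(\tfrac{L(n)}{n}\right)\right\}=\max_{x\in\mathbb{R}}\,[g(x)-\widetilde{\Lambda}^*(x)].$$
   Context: $X_1,X_2,\ldots$ are i.i.d. with $\mathbb{P}(X_i=1)=p$, $\mathbb{P}(X_i=0)=1-p$. For $n\ge 1$, $L(n)$ is the largest integer $\ell\ge 0$ such that $X_{i+1}+\cdots+X_{i+\ell}=\ell$ for some $0\le i\le n-\ell$. $\ln$ is the natural logarithm, $\log_{1/p}$ is the logarithm with base $1/p$, $\mathbb{R}_+=[0,\infty)$, $\mathbf 1_A$ is the indicator of $A$, and $\ln 0=-\infty$. The functions $\Lambda^*,\widetilde\Lambda^*:\mathbb{R}\to[0,\infty]$ are $$\Lambda^*(x)=\begin{cases}+\infty, & x<1,\\ (x-1)\ln(1/p), & x\ge 1,\end{cases}\qquad \widetilde{\Lambda}^*(x)=\begin{cases}x\ln(1/p), & 0\le x\le 1,\\ +\infty, & x<0\text{ or }x>1.\end{cases}$$ The differences $f-\Lambda^*$ and $g-\widetilde\Lambda^*$ are taken to be $-\infty$ wherever the rate function is $+\infty$ (in particular for $x<0$, where $f$ and $g$ are not defined), so the maxima are effectively over $x\ge 1$ and over $x\in[0,1]$ respectively. *)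

(* Defs.v *)
From HB Require Import structures.
From mathcomp Require Export all_boot all_order all_algebra finmap.
From mathcomp Require Export all_classical all_reals all_analysis.
Export Order.TTheory GRing.Theory Num.Theory.
Export numFieldNormedType.Exports.

Set Implicit Arguments.
Unset Strict Implicit.
Unset Printing Implicit Defensive.

Local Open Scope classical_set_scope.
Local Open Scope ring_scope.

Definition mutually_independent (R : realType) (d : measure_display)
    (T : measurableType d) (P : probability T R) (I : choiceType)
    (X : I -> {RV P >-> R}) : Prop :=
  forall (J : {fset I}) (B : I -> set R),
    (forall i, i \in J -> measurable (B i)) ->
    P (\bigcap_(i in [set` J]) (X i @^-1` B i)) =
    (\prod_(i <- J) P (X i @^-1` B i))%E.

(* The two point masses add up to 1, so they determine the law of each X i;
   in particular the X i are identically distributed. *)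
Definition iid_bernoulli (R : realType) (d : measure_display)
    (T : measurableType d) (P : probability T R) (p : R)
    (X : nat -> {RV P >-> R}) : Prop :=
  mutually_independent X /\
  forall i, P (X i @^-1` [set 1]) = p%:E /\
            P (X i @^-1` [set 0]) = (1 - p)%:E.

(* The sequence X_1, X_2, ... is indexed from 0: x j is the (j+1)-st term, so
   that X_(i+1) + ... + X_(i+l) is the sum of the x j for i <= j < i + l. *)
Definition longest_run (R : realType) (x : nat -> R) (n : nat) : nat :=
  \max_(l < n.+1 |
        [exists i : 'I_(n - l).+1, \sum_(i <= j < i + l) x j == l%:R]) l.

Definition run_length (R : realType) (d : measure_display)
    (T : measurableType d) (P : probability T R) (X : nat -> {RV P >-> R})
    (n : nat) (w : T) : R :=
  (longest_run (fun j => X j w) n)%:R.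

Definition log_base (R : realType) (b x : R) : R := ln x / ln b.

(* log_(1/p) n; since ln 0 = 0, the value at the irrelevant index n = 0 is 0. *)
Definition ell (R : realType) (p : R) (n : nat) : R := log_base p^-1 n%:R.

(* (1/a) ln E[Y], with ln 0 = -oo and ln +oo = +oo. *)
Definition scaled_ln_mean (R : realType) (d : measure_display)
    (T : measurableType d) (P : probability T R) (a : R) (Y : T -> R) :
    \bar R :=
  ((a^-1)%:E * lne 'E_P[Y])%E.

Definition rate (R : realType) (p x : R) : \bar R :=
  if x < 1 then +oo%E else ((x - 1) * ln p^-1)%:E.

Definition rate_tilde (R : realType) (p x : R) : \bar R :=
  if (0 <= x) && (x <= 1) then (x * ln p^-1)%:E else +oo%E.

(* In \bar R, r%:E - +oo = -oo, which is the convention for the difference where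
   the rate function is infinite, and in particular for x < 0. *)
Definition rate_gap (R : realType) (f : R -> R) (I : R -> \bar R) (x : R) :
    \bar R :=
  ((f x)%:E - I x)%E.

Definition is_maximum (R : realType) (A : set (\bar R)) (M : \bar R) : Prop :=
  A M /\ ubound A M.

(* Main.v *)
(** Varadhan's lemma for the laws of L(n) / a(n), with a(n) = ell(n) or a(n) = n.

Since L(n) takes finitely many values, all expectations are finite sums against
its law. Writing c = ln (1/p), a union bound over starting points gives
P(L(n) >= k) <= (n + 1) p^k, and splitting the first n trials into m disjoint
blocks of length k gives P(L(n) < k) <= (1 - p^k)^m. Together they give, up to
factors polynomial in a(n), P(L(n) >= y a(n)) = exp(-c (y - b) a(n)), with b = 1
for y >= 1 in part (I), where n = exp(c ell(n)), and b = 0 for y in [0, 1] in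
part (II). The mass near x is a difference of two such tails.

In Varadhan's lemma the upper bound uses a finite subcover of [0, K], exponential
tightness beyond K, and the tail condition where f is large. The maximum is
attained because the lower bound turns the tail condition into
f - rate <= f(x0) - rate(x0) where f is large, while the rate is coercive where
f is bounded. Condition (b) implies condition (a) by exponential Chebyshev. *)

Require Import Defs.
From mathcomp Require Import measurable_realfun ring lra.

Set Implicit Arguments.
Unset Strict Implicit.
Unset Printing Implicit Defensive.

Local Open Scope classical_set_scope.
Local Open Scope ring_scope.

(** * Varadhan's lemma *)

(* Mean of phi(L / a) when L has mass q k at each k <= n. *)
Definition scaled_mean (R : realType) (q : nat -> R) (n : nat) (a : R)
    (phi : R -> R) : R :=
  \sum_(k < n.+1) phi (k%:R / a) * q k.

Section ScaledMean.
Context (R : realType) (q : nat -> R) (n : nat) (a : R).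
Context (q_ge0 : forall k, 0 <= q k) (a_gt0 : 0 < a).
Local Notation W := (scaled_mean q n a).
Implicit Types phi psi : R -> R.

Lemma scaled_meanD phi psi : W (fun z => phi z + psi z) = W phi + W psi.
Proof.
by rewrite /scaled_mean -big_split; apply: eq_bigr => k _; rewrite mulrDl.
Qed.

Lemma scaled_meanZ c phi : W (fun z => c * phi z) = c * W phi.
Proof.
by rewrite /scaled_mean mulr_sumr; apply: eq_bigr => k _; rewrite mulrA.
Qed.

Lemma le_scaled_mean phi psi :
  (forall z, 0 <= z -> phi z <= psi z) -> W phi <= W psi.
Proof.
move=> h; apply: ler_sum => k _; apply: ler_wpM2r => //.
by apply: h; rewrite divr_ge0// ltW.
Qed.

Lemma scaled_mean_sum (I : Type) (s : seq I) (F : I -> R -> R) :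
  W (fun z => \sum_(i <- s) F i z) = \sum_(i <- s) W (F i).
Proof.
rewrite /scaled_mean exchange_big; apply: eq_bigr => k _.
by rewrite mulr_suml.
Qed.

End ScaledMean.

Lemma continuous_ge0_near (R : realType) (f : R -> R) (x e : R) :
  {within [set x | 0 <= x], continuous f} -> 0 <= x -> 0 < e ->
  exists2 dl : R, 0 < dl & forall z : R, 0 <= z -> ball x dl z -> `|f x - f z| < e.
Proof.
move=> /subspace_continuousP cf x0 e0.
have /cvgr_dist_lt/(_ _ e0) := cf x x0.
rewrite near_withinE => -[dl /= dl0 h]; exists dl => // z z0 xz.
exact: h.
Qed.

Section Varadhan.
Context (R : realType) (q : nat -> nat -> R) (a : nat -> R).
Context (q_ge0 : forall n k, 0 <= q n k) (a_pinfty : a @ \oo --> +oo).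
(** [D] is the effective domain of a rate function equal to [r] on [D] and to +oo elsewhere. The
    premise [D x -> c < r x] of [local_upper] thus says that c lies below the rate at x, and off [D]
    every c is allowed. *)
Context (D : set R) (r f : R -> R).
Context (D_ge0 : D `<=` [set x | 0 <= x]) (D_closed : closed D).
Context (D_nonempty : D !=set0) (r_cont : continuous r).
Context (f_cont : {within [set x | 0 <= x], continuous f}).
Local Notation W n phi := (scaled_mean (q n) n (a n) phi).
Context (r_coercive : forall c, exists K, forall x, D x -> K < x -> c <= r x).
Context (local_lower : forall x c dl : R, D x -> r x < c -> 0 < dl ->
  \forall n \near \oo, expR (- (c * a n)) <= W n \1_(ball x dl)).
Context (local_upper : forall x c : R, 0 <= x -> (D x -> c < r x) ->
  exists2 dl : R, 0 < dl &
    \forall n \near \oo, W n \1_(ball x dl) <= expR (- (c * a n))).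
Context (exp_tight : forall c : R, exists K : R,
  \forall n \near \oo, W n \1_[set z | K < z] <= expR (- (c * a n))).
Context (f_tail : forall c : R, exists m : R, \forall n \near \oo,
  W n (fun z => expR (a n * f z) * \1_[set z' | m <= f z'] z)
  <= expR (- (c * a n))).

Let a_near_gt0 : \forall n \near \oo, 0 < a n.
Proof. by move/cvgryPgt: a_pinfty; exact. Qed.

(** Only a small ball around x is kept, where f is nearly constant. The indicator stays in the bound
    so that [varadhan_max] can set it against [f_tail]. *)
Lemma varadhan_lower (x c m : R) : D x -> c < f x - r x -> m < f x ->
  \forall n \near \oo, expR (c * a n) <=
    W n (fun z => expR (a n * f z) * \1_[set z' | m <= f z'] z).
Proof.
(* The loss e occurs twice, in f and in the rate, hence the half; the second bound places the ball
   inside the set where m <= f. *)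
move=> Dx cx mx; pose e := Num.min ((f x - r x - c) / 2) (f x - m).
have e0 : 0 < e by rewrite lt_min; apply/andP; split; lra.
have e1 : e <= (f x - r x - c) / 2 by rewrite ge_min lexx.
have e2 : e <= f x - m by rewrite ge_min lexx orbT.
have [dl dl0 hdl] := continuous_ge0_near f_cont (D_ge0 Dx) e0.
have rx : r x < r x + e by lra.
near=> n.
have an0 : 0 < a n by near: n.
have low : expR (- ((r x + e) * a n)) <= W n \1_(ball x dl).
  by near: n; exact: local_lower.
apply: (@le_trans _ _ (W n (fun z => expR (a n * (f x - e)) * \1_(ball x dl) z))).
  rewrite scaled_meanZ.
  apply: le_trans (ler_wpM2l (expR_ge0 _) low).
  rewrite -expRD ler_expR.
  have -> : a n * (f x - e) - (r x + e) * a n = (f x - r x - e *+ 2) * a n by ring.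
  by rewrite ler_pM2r//; lra.
apply: le_scaled_mean => // z z0; rewrite !indicE.
have [zb|] := boolP (z \in (ball x dl : set R)); last first.
  by move=> _; rewrite mulr0 mulr_ge0// expR_ge0.
have := hdl z z0 (set_mem zb); rewrite ltr_norml => /andP[h1 h2].
rewrite mem_set /=; last lra.
by rewrite !mulr1 ler_expR ler_pM2l//; lra.
Unshelve. all: by end_near. Qed.

Lemma varadhan_max :
  exists2 x, D x & forall y, D y -> f y - r y <= f x - r x.
Proof.
case: D_nonempty => x0 Dx0; pose c0 := f x0 - r x0.
have [m hm] := f_tail (- c0).
(* Beyond K, a point with f y <= m has f y - r y <= m - (m - c0) = c0, so it cannot beat x0. *)
have [K hK] := r_coercive (m - c0).
have le_c0 y : D y -> m < f y -> f y - r y <= c0.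
  move=> Dy my; rewrite leNgt; apply/negP => yc.
  (* The midpoint is an exponent strictly above c0 for which the lower bound still holds,
     contradicting the tail bound exp(c0 a n). *)
  have yc' : (c0 + (f y - r y)) / 2 < f y - r y by lra.
  have low := varadhan_lower Dy yc' my.
  near \oo => n.
  have an0 : 0 < a n by near: n.
  have : expR ((c0 + (f y - r y)) / 2 * a n) <= expR (- (- c0 * a n)).
    by apply: (@le_trans _ _ (W n
      (fun z => expR (a n * f z) * \1_[set z' | m <= f z'] z))); near: n.
  by rewrite ler_expR mulNr opprK ler_pM2r//; lra.
pose A := D `&` `[0, Num.max K x0].
have A0 : A !=set0.
  exists x0; split => //=; rewrite in_itv/= le_max lexx orbT andbT.
  exact: D_ge0.
have Ac : compact A.
  by rewrite /A setIC; apply: compact_closedI => //; exact: segment_compact.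
have fr : {within A, continuous (fun x => f x - r x)}.
  have fA : {within A, continuous f}.
    by apply: continuous_subspaceW f_cont => y [/D_ge0].
  move=> y; apply: cvgB; first exact: fA.
  exact: (continuous_subspaceT r_cont).
have [x /set_mem[Dx _] xmax] := compact_EVT_max A0 Ac fr.
exists x => // y Dy.
have [yA|yK] := leP y (Num.max K x0).
  by apply: xmax; apply/mem_set; split=> //=; rewrite in_itv/= yA andbT; exact: D_ge0.
have c0x : c0 <= f x - r x.
  apply: xmax; apply/mem_set; split=> //=.
  by rewrite in_itv/= le_max lexx orbT andbT; exact: D_ge0.
apply: le_trans c0x.
have [my|ym] := ltP m (f y); first exact: le_c0.
have : m - c0 <= r y by apply: hK => //; apply: le_lt_trans yK; rewrite le_max lexx.
lra.
Unshelve. all: by end_near. Qed.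

Lemma varadhan_upper (M e : R) : (forall x, D x -> f x - r x <= M) -> 0 < e ->
  \forall n \near \oo, W n (fun z => expR (a n * f z)) <= expR ((M + e) * a n).
Proof.
move=> maxM e0.
(* The half-line z >= 0 is split into the part where m <= f, the part z > K where f < m, and [0, K].
   The levels of [m] and [K] make each of the first two contribute at most exp(M a n). *)
have [m hm] := f_tail (- M).
have [K hK] := exp_tight (m - M).
have /choice[dl hdl] : forall x : R, exists dl : R, 0 <= x -> 0 < dl /\
    \forall n \near \oo, W n (fun z => expR (a n * f z) * \1_(ball x dl) z) <=
      expR ((M + e / 2) * a n).
  move=> x; have [x0|x0] := leP 0 x; last by exists 0.
  have e4 : 0 < e / 4 by lra.
  have [dl1 dl10 h1] := continuous_ge0_near f_cont x0 e4.
  (* This level equals f x - M - e/4, which is below r x on [D] because f x - r x <= M. Against the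
     growth exp((f x + e/4) a n) on the ball it leaves exp((M + e/2) a n). *)
  have [|dl2 dl20 h2] := @local_upper x (f x + e / 4 - (M + e / 2)) x0.
    by move=> /maxM; lra.
  exists (Num.min dl1 dl2) => _; split; first by rewrite lt_min dl10.
  near=> n.
  have an0 : 0 < a n by near: n.
  apply: (@le_trans _ _
    (W n (fun z => expR (a n * (f x + e / 4)) * \1_(ball x dl2) z))).
    apply: le_scaled_mean => // z z0; rewrite !indicE.
    have [zb|] := boolP (z \in (ball x (Num.min dl1 dl2) : set R)); last first.
      by move=> _; rewrite mulr0 mulr_ge0// expR_ge0.
    have zb1 : ball x dl1 z.
      by apply: le_ball (set_mem zb); rewrite ge_min lexx.
    rewrite (@mem_set _ (ball x dl2 : set R)); last first.
      by apply: le_ball (set_mem zb); rewrite ge_min lexx orbT.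
    rewrite !mulr1 ler_expR ler_pM2l//.
    by have := h1 z z0 zb1; rewrite ltr_norml => /andP[]; lra.
  rewrite scaled_meanZ.
  apply: le_trans (_ : _ <= expR (a n * (f x + e / 4)) *
    expR (- ((f x + e / 4 - (M + e / 2)) * a n))) _.
    by rewrite ler_pM2l ?expR_gt0//; near: n.
  rewrite -expRD ler_expR; rewrite le_eqVlt; apply/orP; left; apply/eqP; ring.
have : compact `[0, K] by exact: segment_compact.
rewrite compact_cover => /(_ R [set` `[0, K]] (fun x => ball x (dl x) : set R)).
case.
- by move=> x; rewrite /= in_itv/= => /andP[x0 _]; apply: ball_open; exact: (hdl x x0).1.
- move=> x; rewrite /= in_itv/= => /andP[x0 xK]; exists x.
    by rewrite /= in_itv/= x0.
  by apply: ballxx; exact: (hdl x x0).1.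
move=> s sK scov.
(* Induction on the list of centres merges finitely many eventual bounds into one. *)
have hs : forall t : seq R, (forall x : R, x \in t -> 0 <= x) ->
    \forall n \near \oo,
      \sum_(x <- t) W n (fun z => expR (a n * f z) * \1_(ball x (dl x)) z) <=
      (size t)%:R * expR ((M + e / 2) * a n).
  elim=> [|x t ih] ht.
    by apply: nearW => n; rewrite big_nil mul0r.
  near=> n; rewrite big_cons /= -natr1 mulrDl mul1r addrC lerD//.
    by near: n; apply: ih => y yt; apply: ht; rewrite inE yt orbT.
  by near: n; apply: (hdl x _).2; apply: ht; rewrite inE eqxx.
have hss : forall x : R, x \in (s : seq R) -> 0 <= x.
  by move=> x /sK/set_mem; rewrite /= in_itv/= => /andP[].
have e2 : 0 < e / 2 by lra.
near=> n.
have an0 : 0 < a n by near: n.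
apply: (@le_trans _ _ (W n (fun z =>
    expR (a n * f z) * \1_[set z' | m <= f z'] z +
    (expR (a n * m) * \1_[set z' | K < z'] z +
     \sum_(x <- s) expR (a n * f z) * \1_(ball x (dl x)) z)))).
  apply: le_scaled_mean => // z z0.
  have p1 : 0 <= expR (a n * f z) * \1_[set z' | m <= f z'] z.
    by rewrite mulr_ge0 ?expR_ge0// indicE.
  have p2 : 0 <= expR (a n * m) * \1_[set z' | K < z'] z.
    by rewrite mulr_ge0 ?expR_ge0// indicE.
  have p3 (x : R) : 0 <= expR (a n * f z) * \1_(ball x (dl x)) z.
    by rewrite mulr_ge0 ?expR_ge0// indicE.
  have p4 : 0 <= \sum_(x <- s) expR (a n * f z) * \1_(ball x (dl x)) z.
    exact: sumr_ge0.
  have [mf|fm] := leP m (f z).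
    have -> : \1_[set z' | m <= f z'] z = 1 :> R by rewrite indicE mem_set.
    by rewrite mulr1; lra.
  have [Kz|zK] := ltP K z.
    suff : expR (a n * f z) <= expR (a n * m) * \1_[set z' | K < z'] z by lra.
    by rewrite indicE mem_set//= mulr1 ler_expR ler_pM2l// ltW.
  have [|x /= xs zx] := scov z; first by rewrite /= in_itv/= z0.
  suff : expR (a n * f z) <=
      \sum_(x <- s) expR (a n * f z) * \1_(ball x (dl x)) z by lra.
  rewrite (big_rem x)//= indicE mem_set// mulr1 lerDl.
  exact: sumr_ge0.
rewrite !scaled_meanD scaled_meanZ scaled_mean_sum.
have t1 : W n (fun z => expR (a n * f z) * \1_[set z' | m <= f z'] z)
    <= expR (- (- M * a n)) by near: n.
have t2 : W n \1_[set z' | K < z'] <= expR (- ((m - M) * a n)) by near: n.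
have t3 : \sum_(x <- s) W n (fun z => expR (a n * f z) * \1_(ball x (dl x)) z) <=
    (size s)%:R * expR ((M + e / 2) * a n) by near: n; exact: hs.
have t2' : expR (a n * m) * W n \1_[set z' | K < z'] <= expR (M * a n).
  apply: le_trans (ler_wpM2l (expR_ge0 _) t2) _.
  by rewrite -expRD ler_expR; rewrite le_eqVlt; apply/orP; left; apply/eqP; ring.
have t1' : expR (- (- M * a n)) <= expR (M * a n) by rewrite mulNr opprK.
have t4 : expR (M * a n) <= expR ((M + e / 2) * a n).
  by rewrite ler_expR ler_pM2r//; lra.
(* The remaining e/2 in the exponent absorbs the fixed number of pieces, since a n tends to
   infinity. *)
have t5 : (2 + (size s)%:R : R) <= expR (e / 2 * a n).
  apply: le_trans (expR_ge1Dx _); rewrite -lerBlDl mulrC -ler_pdivrMr//.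
  by near: n; move/cvgryPge: a_pinfty; exact.
have -> : (M + e) * a n = e / 2 * a n + (M + e / 2) * a n by field.
rewrite expRD.
apply: le_trans (ler_wpM2r (expR_ge0 _) t5).
rewrite mulrDl; lra.
Unshelve. all: by end_near. Qed.

End Varadhan.

(** * The law of the longest run *)

Lemma limn_esup_lt (R : realType) (u : nat -> \bar R) (c : \bar R) :
  (limn_esup u < c)%E -> \forall n \near \oo, (u n < c)%E.
Proof.
rewrite /limn_esup /limf_esup => /ereal_inf_lt[_ [A Aoo <-] Ac].
apply: filterS Aoo => n An; apply: le_lt_trans Ac.
by apply: ereal_sup_ubound; exists n.
Qed.

Section ScaledLnMean.
Context (R : realType) (d : measure_display) (T : measurableType d).
Context (P : probability T R) (a : R) (a_gt0 : 0 < a) (Y : T -> R) (w : R).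
Context (meanY : ('E_P[Y] = w%:E)%E).

Lemma scaled_ln_meanE : 0 < w -> scaled_ln_mean P a Y = (ln w / a)%:E.
Proof.
by move=> w0; rewrite /scaled_ln_mean meanY lne_EFin// -EFinM mulrC.
Qed.

Lemma scaled_ln_mean_le c :
  (scaled_ln_mean P a Y <= c%:E)%E -> w <= expR (c * a).
Proof.
have [w0|w0] := leP w 0; first by move=> _; apply: le_trans w0 (expR_ge0 _).
rewrite scaled_ln_meanE// lee_fin ler_pdivrMr// => h.
by rewrite -[w]lnK ?posrE// ler_expR.
Qed.

End ScaledLnMean.

(** The terms of x are arbitrary reals, so a window of length l with sum l need not contain one of
    length k with sum k. Hence the quantifier over all l >= k. *)
Lemma longest_run_geP (R : realType) (x : nat -> R) (n k : nat) : (0 < k)%N ->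
  (k <= longest_run x n)%N <->
  exists l i, [/\ (k <= l)%N, (i + l <= n)%N &
    \sum_(i <= j < i + l) x j = l%:R].
Proof.
move=> k0; split.
  apply: contraPP => h; apply/negP; rewrite -ltnNge.
  rewrite -(prednK k0) ltnS; apply/bigmax_leqP => l /existsP[i /eqP il].
  rewrite -ltnS prednK// ltnNge; apply/negP => kl; apply: h.
  exists l, i; split => //.
  by rewrite addnC -leq_subRL -ltnS ltn_ord.
move=> [l [i [kl iln il]]]; apply: leq_trans kl _.
have ln : (l < n.+1)%N by rewrite ltnS; apply: leq_trans iln; exact: leq_addl.
have i_lt : (i < (n - l).+1)%N by rewrite ltnS leq_subRL 1?addnC// -ltnS.
apply: (@leq_bigmax_cond _ _ (fun l : 'I_n.+1 => l : nat) (Ordinal ln)).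
by apply/existsP; exists (Ordinal i_lt); apply/eqP.
Qed.

Lemma longest_run_le (R : realType) (x : nat -> R) (n : nat) :
  (longest_run x n <= n)%N.
Proof. by apply/bigmax_leqP => l _; rewrite -ltnS ltn_ord. Qed.

Section RunLaw.
Context (R : realType) (d : measure_display) (T : measurableType d).
Context (P : probability T R) (X : nat -> {RV P >-> R}).
Local Notation L n w := (longest_run (fun j => X j w) n).

Lemma measurable_block_sum (i l : nat) (c : R) :
  measurable [set w | \sum_(i <= j < i + l) X j w = c].
Proof.
have mf : measurable_fun setT (fun w => \sum_(i <= j < i + l) X j w).
  by apply: measurable_sum => j; exact: measurable_funPT.
by rewrite -[X in measurable X]setTI; exact: (mf measurableT _ (measurable_set1 c)).
Qed.

Lemma measurable_longest_run (n : nat) (B : set nat) :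
  measurable [set w | B (L n w)].
Proof.
have mge k : measurable [set w | (k <= L n w)%N].
  have [->|k0] := posnP k.
    by rewrite (_ : [set _ | _] = setT)//; apply/seteqP.
  rewrite (_ : [set _ | _] = \bigcup_(l in [set l | (k <= l)%N])
      \bigcup_(i in [set i | (i + l <= n)%N])
      [set w | \sum_(i <= j < i + l) X j w = l%:R]).
    by apply: bigcup_measurable => l _; apply: bigcup_measurable => i _;
      exact: measurable_block_sum.
  apply/seteqP; split => w /=.
    by move/(longest_run_geP _ _ k0) => [l [i [kl il h]]]; exists l => //; exists i.
  by move=> [l kl [i il h]]; apply/(longest_run_geP _ _ k0); exists l, i.
rewrite (_ : [set _ | _] = \bigcup_(k in B)
    ([set w | (k <= L n w)%N] `\` [set w | (k < L n w)%N])).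
  by apply: bigcup_measurable => k _; exact: measurableD.
apply/seteqP; split => w /=.
  by move=> Bw; exists (L n w) => //=; split => //; rewrite ltnn.
by move=> [k Bk [/= h1 /negP]]; rewrite -leqNgt => h2;
  rewrite (_ : L n w = k)//; apply/eqP; rewrite eqn_leq h1 h2.
Qed.

Definition run_law (n k : nat) : R := fine (P [set w | L n w = k]).

Lemma run_law_ge0 n k : 0 <= run_law n k.
Proof. exact: fine_ge0. Qed.

Lemma expectation_run_length (n : nat) (a : R) (phi : R -> R) :
  (forall z, 0 <= phi z) ->
  ('E_P[fun w => phi (run_length X n w / a)%R] =
   (scaled_mean (run_law n) n a phi)%:E)%E.
Proof.
move=> phi0; rewrite unlock /scaled_mean.
have mk (k : nat) := measurable_longest_run n [set k].
(* As L(n) <= n, exactly one of the indicators of L(n) = k is 1 at each outcome. *)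
transitivity (\int[P]_w \sum_(k < n.+1)
    (phi (k%:R / a)%R)%:E * (\1_[set w' | L n w' = k] w)%:E)%E.
  apply: eq_integral => w _; rewrite /run_length.
  have Ln : (L n w < n.+1)%N by rewrite ltnS longest_run_le.
  rewrite (bigD1 (Ordinal Ln))//= indicE mem_set//= mule1 big1 ?adde0// => k kL.
  rewrite indicE memNset ?mule0//= => Lk.
  by move/eqP: kL; apply; apply: val_inj.
rewrite ge0_integral_sum//.
- rewrite -sumEFin; apply: eq_bigr => k _.
  rewrite ge0_integralZl//.
  + rewrite integral_indic//; last exact: mk.
    rewrite setIT EFinM fineK//.
    by apply: fin_num_measure; exact: mk.
  + exact/measurable_EFinP/measurable_indic/mk.
  + by rewrite lee_fin.
- move=> k; apply: measurable_funeM.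
  exact/measurable_EFinP/measurable_indic/mk.
- by move=> k w _; rewrite mule_ge0// lee_fin.
Qed.

Lemma scaled_mean_indic (n : nat) (a : R) (A : set R) :
  (P [set w | A (run_length X n w / a)%R] =
   (scaled_mean (run_law n) n a \1_A)%:E)%E.
Proof.
rewrite -expectation_run_length//.
have mA := measurable_longest_run n [set k | A (k%:R / a)].
exact/esym/(expectation_indic P mA).
Qed.

End RunLaw.

(** * Tail bounds for the longest run *)

Section RunTails.
Context (R : realType) (d : measure_display) (T : measurableType d).
Context (P : probability T R) (p : R) (X : nat -> {RV P >-> R}).
Context (p_gt0 : 0 < p) (p_lt1 : p < 1) (X_iid : iid_bernoulli p X).
Local Notation L n w := (longest_run (fun j => X j w) n).

(** Indexing by finite sets turns intersections of events into unions of index sets, and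
    independence into a power of p given by the cardinality. *)
Definition all_ones (J : {fset nat}) : set T :=
  \bigcap_(i in [set` J]) (X i @^-1` [set 1]).

Lemma measurable_preim1 i (c : R) : measurable (X i @^-1` [set c]).
Proof.
have mX : measurable_fun setT (X i) by exact: measurable_funPT.
by rewrite -[Y in measurable Y]setTI; exact: (mX measurableT _ (measurable_set1 c)).
Qed.

Lemma measurable_all_ones J : measurable (all_ones J).
Proof. by apply: bigcap_measurableType => i _; exact: measurable_preim1. Qed.

Lemma prob_all_ones J : P (all_ones J) = (p ^+ #|` J|)%:E.
Proof.
have [ind law] := X_iid.
rewrite /all_ones (ind J (fun=> [set 1]))//.
under eq_bigr do rewrite (law _).1.
rewrite big_const_seq count_predT; elim: (size _) => //= n ->.
by rewrite exprS EFinM.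
Qed.

Lemma all_onesU (J K : {fset nat}) :
  all_ones (J `|` K)%fset = all_ones J `&` all_ones K.
Proof.
apply/seteqP; split => w.
  by move=> h; split => i iJ; apply: h => /=; rewrite inE iJ ?orbT.
by move=> [hJ hK] i /=; rewrite inE => /orP[]; [exact: hJ|exact: hK].
Qed.

Definition window (i l : nat) : {fset nat} := [fset j in iota i l]%fset.

Lemma card_window i l : #|` window i l| = l.
Proof. by rewrite /window card_imfset//= undup_id ?iota_uniq// size_iota. Qed.

Lemma mem_window i l j : (j \in window i l) = (i <= j < i + l)%N.
Proof. by rewrite !inE mem_iota. Qed.

(* S collects the full window subtracted at each step of the induction. *)
Lemma prob_no_full_window k m (S : {fset nat}) :
  (forall i, i \in S -> (m * k <= i)%N) ->
  P (\big[setI/setT]_(j < m) (~` all_ones (window (j * k) k)) `&` all_ones S) =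
  ((1 - p ^+ k) ^+ m * p ^+ #|` S|)%:E.
Proof.
elim: m S => [|m ih] S hS.
  by rewrite big_ord0 setTI expr0 mul1r prob_all_ones.
pose N := \big[setI/setT]_(j < m) (~` all_ones (window (j * k) k)).
have mN : measurable N.
  by apply: bigsetI_measurable => j _; exact/measurableC/measurable_all_ones.
have hS' i : i \in S -> (m * k <= i)%N.
  by move/hS; apply: leq_trans; rewrite leq_mul2r leqnSn orbT.
have hW i : i \in (window (m * k) k `|` S)%fset -> (m * k <= i)%N.
  by rewrite inE => /orP[|/hS'//]; rewrite mem_window => /andP[].
(* The new window ends before (m + 1) k, where [S] starts, so the cardinalities add. *)
have cW : #|` (window (m * k) k `|` S)%fset| = (k + #|` S|)%N.
  rewrite cardfsU card_window.
  rewrite (_ : (_ `&` _)%fset = fset0) ?cardfs0 ?subn0//.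
  apply/fsetP => i; rewrite inE mem_window [RHS]inE.
  apply/negP => /andP[/andP[_ im] /hS]; apply/negP.
  by rewrite -ltnNge mulSn addnC.
rewrite big_ord_recr/= -/N.
rewrite (_ : _ `&` _ = (N `&` all_ones S) `\`
    all_ones (window (m * k) k)); last first.
  by rewrite setDE -!setIA; congr (_ `&` _); rewrite setIC.
rewrite measureD; last 3 first.
- by apply: measurableI => //; exact: measurable_all_ones.
- exact: measurable_all_ones.
- by rewrite ltey_eq fin_num_measure//; apply: measurableI => //; exact: measurable_all_ones.
(* The induction hypothesis is used for [S] and for [S] joined with the new window; the difference
   of the two values yields the extra factor 1 - p^k. *)
have := ih _ hW; have := ih S hS'; rewrite -/N => ihS ihW.
rewrite -setIA [Y in (_ - _ (N `&` Y))%E]setIC -all_onesU.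
transitivity (((1 - p ^+ k) ^+ m * p ^+ #|` S|)%:E -
    ((1 - p ^+ k) ^+ m * p ^+ (k + #|` S|))%:E)%E.
  by rewrite -cW; congr (_ - _)%E.
rewrite -EFinB; congr EFin; rewrite exprD exprS; ring.
Qed.

Lemma prob_run_lt n k m : (m * k <= n)%N ->
  (P [set w | (L n w < k)%N] <= ((1 - p ^+ k) ^+ m)%:E)%E.
Proof.
move=> mkn; have := @prob_no_full_window k m fset0.
rewrite cardfs0 expr0 mulr1 => <-//.
apply: le_measure.
- by rewrite inE; exact: (measurable_longest_run X n [set l | (l < k)%N]).
- rewrite inE; apply: measurableI; last exact: measurable_all_ones.
  by apply: bigsetI_measurable => j _; exact/measurableC/measurable_all_ones.
move=> w /= Lk; split; last by move=> i /=; rewrite inE.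
rewrite -(bigcap_mkord m (fun j => ~` all_ones (window (j * k) k))).
move=> j /= jm ones; move: Lk; apply/negP; rewrite -leqNgt.
have [->//|k0] := posnP k.
apply/longest_run_geP => //; exists k, (j * k)%N; split => //.
  by apply: leq_trans mkn; rewrite addnC -mulSn leq_mul2r jm orbT.
rewrite (eq_big_nat _ _ (F2 := fun=> 1)).
  by rewrite sumr_const_nat addKn.
by move=> i ij; apply: ones; rewrite /= mem_window.
Qed.

(** The variables are real-valued and lie in {0, 1} only almost surely. Off this null event a block
    of length l with sum l consists of ones, which is what [prob_run_ge] relies on. *)
Lemma prob_not_bernoulli i : P (~` (X i @^-1` [set 1] `|` X i @^-1` [set 0])) = 0%E.
Proof.
have [_ law] := X_iid; have [h1 h0] := law i.
have m1 := measurable_preim1 i 1; have m0 := measurable_preim1 i 0.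
rewrite probability_setC; last exact: measurableU.
rewrite measureU//; last first.
  apply/seteqP; split => // w [/= -> /eqP]; by rewrite oner_eq0.
transitivity (1 - (p%:E + (1 - p)%:E))%E; first by congr (_ - (_ + _))%E.
transitivity (1 - (p + (1 - p)))%:E; first by [].
by congr EFin; ring.
Qed.

Lemma prob_run_ge n k :
  (P [set w | (k <= L n w)%N] <= (n.+1%:R * p ^+ k)%:E)%E.
Proof.
have mL : measurable [set w | (k <= L n w)%N].
  exact: (measurable_longest_run X n [set l | (k <= l)%N]).
have [k0|k0] := posnP k.
  apply: le_trans (probability_le1 P mL) _.
  by rewrite k0 expr0 mulr1 lee_fin ler1n.
pose bad i := ~` (X i @^-1` [set 1] `|` X i @^-1` [set 0]).
have mbad i : measurable (bad i).
  by apply/measurableC/measurableU; exact: measurable_preim1.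
pose Bad := \big[setU/set0]_(i < n) bad i.
(* Starting points run up to n, so late windows may reach beyond the first n trials; this is
   harmless for an upper bound. *)
pose Ones := \big[setU/set0]_(i < n.+1) all_ones (window i k).
have mBad : measurable Bad by exact: bigsetU_measurable.
have mOnes : measurable Ones.
  by apply: bigsetU_measurable => i _; exact: measurable_all_ones.
have Bad0 : P Bad = 0%E.
  apply/eqP; rewrite eq_le measure_ge0 andbT.
  have mb i : `I_n i -> measurable (bad i) by [].
  apply: (le_trans (content_subadditive P mb mBad (@subset_refl _ _))) => //.
  by rewrite big1// => i _; exact: prob_not_bernoulli.
have POnes : (P Ones <= (n.+1%:R * p ^+ k)%:E)%E.
  have mw i : `I_n.+1 i -> measurable (all_ones (window i k)).
    by move=> _; exact: measurable_all_ones.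
  apply: (le_trans (content_subadditive P mw mOnes (@subset_refl _ _))) => //.
  rewrite (eq_bigr (fun=> (p ^+ k)%:E)); last first.
    by move=> i _; rewrite -[k in RHS](card_window i); exact: prob_all_ones.
  by rewrite sumEFin lee_fin sumr_const card_ord mulr_natl.
have sub : [set w | (k <= L n w)%N] `<=` Ones `|` Bad.
  move=> w /= /(longest_run_geP _ _ k0)[l [i [kl iln sl]]].
  have [|nBad] := pselect (Bad w); [by right|left].
  rewrite /Ones -(bigcup_mkord _ (fun i => all_ones (window i k))); exists i => /=.
    by rewrite ltnS; apply: leq_trans iln; exact: leq_addr.
  have X01 j : (i <= j < i + l)%N -> X j w = 1 \/ X j w = 0.
    move=> /andP[_ jl]; have jn : (j < n)%N by exact: leq_trans jl iln.
    apply: contrapT => nX; apply: nBad; rewrite /Bad -(bigcup_mkord _ bad).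
    by exists j.
  (* For values in {0, 1} the terms 1 - X_j are nonnegative, so a zero sum forces every X_j in the
     block to be 1. *)
  have : \sum_(i <= j < i + l) (1 - X j w) = 0.
    by rewrite sumrB sl sumr_const_nat addKn subrr.
  move/eqP; rewrite big_nat psumr_eq0; last first.
    by move=> j /X01[]->; rewrite ?subrr ?subr0.
  move=> /allP h j /=; rewrite mem_window => /andP[ij jk].
  have jl : (i <= j < i + l)%N.
    by rewrite ij; apply: leq_trans jk _; rewrite leq_add2l.
  have := h j; rewrite mem_index_iota jl /= => /(_ isT).
  by rewrite subr_eq0 => /eqP.
apply: le_trans POnes.
have -> : P Ones = (P Ones + P Bad)%E by rewrite Bad0 adde0.
apply: le_trans (measureU2 _ mOnes mBad).
by apply: le_measure; rewrite ?inE//; exact: measurableU.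
Qed.

End RunTails.

(** * Elementary inequalities *)

Lemma nat_ceil (R : realType) (t : R) :
  exists k : nat, (forall l : nat, (t <= l%:R) = (k <= l)%N) /\
    (0 <= t -> k%:R < t + 1).
Proof.
have ex : exists k : nat, t <= k%:R.
  exists (Num.bound `|t|); apply: ltW.
  exact: le_lt_trans (ler_norm t) (archi_boundP (normr_ge0 t)).
case: (ex_minnP ex) => k tk kmin; exists k; split.
  move=> l; apply/idP/idP => [|kl]; first exact: kmin.
  by apply: le_trans tk _; rewrite ler_nat.
move=> t0; case: k tk kmin => [|k] tk kmin; first by rewrite ltr_wpDl.
rewrite -natr1 ltrD2r ltNge; apply/negP => /kmin.
by rewrite ltnn.
Qed.

Lemma pow_le_expR (R : realType) (q : R) m : 0 <= q <= 1 ->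
  (1 - q) ^+ m <= expR (- (m%:R * q)).
Proof.
move=> /andP[q0 q1]; rewrite -mulrN expRM_natl.
apply: lerXn2r; rewrite ?nnegrE ?expR_ge0 ?subr_ge0//.
exact: expR_ge1Dx.
Qed.

(** Equivalently 1 - (1 - q)^m >= m q / (1 + m q): the chance of at least one success is of the
    order of the expected number m q as long as the latter is bounded. *)
Lemma pow_mul_le1 (R : realType) (q : R) m : 0 <= q <= 1 ->
  (1 - q) ^+ m * (1 + m%:R * q) <= 1.
Proof.
move=> /andP[q0 q1]; elim: m => [|m ih]; first by rewrite expr0 mul0r addr0 mulr1.
apply: le_trans ih; rewrite exprSr -mulrA ler_wpM2l//.
  by rewrite exprn_ge0// subr_ge0.
(* This is the term lost in (1 - q)(1 + (m + 1) q) = 1 + m q - (m + 1) q^2. *)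
rewrite -natr1; have : 0 <= (m%:R + 1) * q ^+ 2 by rewrite mulr_ge0// ?sqr_ge0// addr_ge0.
nra.
Qed.

Lemma poly_expRN_le1 (R : realType) (a : nat -> R) (C kappa : R) :
  a @ \oo --> +oo -> 0 < kappa ->
  \forall n \near \oo, C * (1 + a n) ^+ 2 * expR (- (kappa * a n)) <= 1.
Proof.
move=> /cvgryPge a_oo k0; near=> n.
have a1 : 1 <= a n by near: n; exact: a_oo.
(* 24 = 4 * 3!, with 4 from (1 + a)^2 <= 4 a^2 for a >= 1 and 3! from the cubic term of the
   exponential series. *)
have aC : 24 * `|C| / kappa ^+ 3 <= a n by near: n; exact: a_oo.
rewrite expRN ler_pdivrMr ?expR_gt0// mul1r.
have kan : 0 <= kappa * a n by nra.
apply: le_trans (expR_ge1Dxn 2 kan).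
rewrite ler_pdivrMr ?exprn_gt0// in aC.
have CC := ler_norm C.
have -> : (3`!%:R : R) = 6 by [].
rewrite exprMn.
set D := `|C| in aC CC *; set K := kappa ^+ 3 in aC *.
have D0 : 0 <= D by rewrite normr_ge0.
have s1 : (1 + a n) ^+ 2 <= 4 * a n ^+ 2 by nra.
have s2 : C * (1 + a n) ^+ 2 <= D * (4 * a n ^+ 2).
  apply: le_trans (ler_wpM2r (sqr_ge0 _) CC) _.
  by rewrite ler_wpM2l.
apply: le_trans s2 _.
have : 24 * D * a n ^+ 2 <= a n * K * a n ^+ 2 by rewrite ler_wpM2r ?sqr_ge0.
have -> : a n ^+ 3 = a n * a n ^+ 2 by rewrite exprS.
lra.
Unshelve. all: by end_near. Qed.

(** * Tails of the rescaled run length *)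

Section RunTailMean.
Context (R : realType) (d : measure_display) (T : measurableType d).
Context (P : probability T R) (p : R) (X : nat -> {RV P >-> R}).
Context (p_gt0 : 0 < p) (p_lt1 : p < 1) (X_iid : iid_bernoulli p X).
Local Notation W n a phi := (scaled_mean (run_law X n) n a phi).
Local Notation c := (ln p^-1).

Lemma ln_invp_gt0 : 0 < c.
Proof. by apply: ln_gt0; rewrite invf_gt1. Qed.

Lemma expr_p_expR k : p ^+ k = expR (- (c * k%:R)).
Proof. by rewrite lnV ?posrE// mulNr opprK expRM_natr lnK// posrE. Qed.

Lemma mean_tail_le n a y : 0 < a ->
  W n a \1_[set z | y <= z] <= n.+1%:R * expR (- (c * y * a)).
Proof.
move=> a0; rewrite -lee_fin -scaled_mean_indic.
have [k [hk _]] := nat_ceil (y * a).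
rewrite (_ : [set _ | _] = [set w | (k <= longest_run (fun j => X j w) n)%N]).
  apply: le_trans (prob_run_ge X_iid n k) _.
  rewrite lee_fin ler_wpM2l// expr_p_expR ler_expR lerN2 -mulrA.
  by rewrite ler_wpM2l ?(ltW ln_invp_gt0)// hk.
by apply/seteqP; split => w /=; rewrite ler_pdivlMr// hk.
Qed.

Lemma mean_below_le n a y k m : 0 < a -> (m * k <= n)%N ->
  (forall l : nat, (y * a <= l%:R) = (k <= l)%N) ->
  W n a \1_[set z | z < y] <= (1 - p ^+ k) ^+ m.
Proof.
move=> a0 mk hk; rewrite -lee_fin -scaled_mean_indic.
rewrite (_ : [set _ | _] = [set w | (longest_run (fun j => X j w) n < k)%N]).
  exact: prob_run_lt.
by apply/seteqP; split => w /=; rewrite ltr_pdivrMr// ltNge hk -ltnNge.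
Qed.

Lemma mean_tail_ge n a y k m : 0 < a -> (m * k <= n)%N ->
  (forall l : nat, (y * a <= l%:R) = (k <= l)%N) ->
  1 - (1 - p ^+ k) ^+ m <= W n a \1_[set z | y <= z].
Proof.
move=> a0 mk hk; have := mean_below_le a0 mk hk.
suff : 1 = W n a \1_[set z | z < y] + W n a \1_[set z | y <= z] by lra.
rewrite -scaled_meanD; apply: EFin_inj.
transitivity (P [set w | setT (run_length X n w / a)]).
  by rewrite -(@probability_setT _ _ _ P).
rewrite scaled_mean_indic; congr EFin.
apply: eq_bigr => i _; congr (_ * _); rewrite !indicE.
rewrite in_setT; have [h|h] := ltP (i%:R / a) y.
  rewrite (mem_set (h : [set z | z < y] _)) memNset ?addr0//=.
  by apply/negP; rewrite -ltNge.
rewrite (mem_set (h : [set z | y <= z] _)) memNset ?add0r//=.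
by apply/negP; rewrite -leNgt.
Qed.

Lemma expR_ell n : (0 < n)%N -> expR (c * ell p n) = n%:R.
Proof.
move=> n0; rewrite /ell /log_base mulrC divfK ?lt0r_neq0 ?ln_invp_gt0//.
by rewrite lnK// posrE ltr0n.
Qed.

Lemma ell_pinfty : ell p @ \oo --> +oo.
Proof.
apply/cvgryPge => A; near=> n.
have n0 : (0 < n)%N by near: n; exists 1%N.
rewrite -(ler_pM2l ln_invp_gt0) -ler_expR expR_ell//.
by near: n; move/cvgryPge: (@cvgr_idn R); exact.
Unshelve. all: by end_near. Qed.

(** Here k is the ceiling of y ell(n), m = n %/ k is the number of disjoint blocks, and m p^k is the
    expected number of blocks full of ones. It equals n^(1 - y) = exp(c (1 - y) ell(n)) up to a
    factor linear in ell(n). *)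
Lemma many_blocks (y : R) : 0 < y ->
  \forall n \near \oo, exists k m : nat,
    [/\ forall l : nat, (y * ell p n <= l%:R) = (k <= l)%N,
        (m * k <= n)%N,
        p / 2 * expR (c * (1 - y) * ell p n) <=
          m%:R * p ^+ k * (y * ell p n + 1) &
        m%:R * p ^+ k <= expR (c * (1 - y) * ell p n)].
Proof.
move=> y0; have c0 := ln_invp_gt0; near=> n.
have n0 : (0 < n)%N by near: n; exists 1%N.
have a0 : 0 < ell p n by near: n; move/cvgryPgt: ell_pinfty; exact.
(* This ensures k <= n, so that at least one block fits. *)
have big : (y + 1) * (1 + ell p n) ^+ 2 <= n%:R.
  have : (y + 1) * (1 + ell p n) ^+ 2 * expR (- (c * ell p n)) <= 1.
    by near: n; exact: poly_expRN_le1 ell_pinfty c0.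
  by rewrite expRN expR_ell// ler_pdivrMr ?ltr0n// mul1r.
have en : expR (c * (1 - y) * ell p n) = n%:R * expR (- (c * y * ell p n)).
  by rewrite -expR_ell// -expRD; congr expR; ring.
have [k [hk ku]] := nat_ceil (y * ell p n).
have {ku}k_lt : k%:R < y * ell p n + 1 by apply: ku; rewrite mulr_ge0// ltW.
have k_ge : y * ell p n <= k%:R by rewrite hk.
have k0 : (0 < k)%N.
  by rewrite -(ltr0n R); apply: lt_le_trans k_ge; rewrite mulr_gt0.
have kn : (k <= n)%N.
  by rewrite -(ler_nat R); apply: ltW; apply: lt_le_trans k_lt _; nra.
(* Rounding y ell(n) up to k costs at most one factor p. *)
have pk_lo : p * expR (- (c * y * ell p n)) <= p ^+ k.
  rewrite -[X in X * _]expr1 !expr_p_expR -expRD ler_expR; nra.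
have pk_up : p ^+ k <= expR (- (c * y * ell p n)).
  by rewrite expr_p_expR ler_expR; nra.
exists k, (n %/ k)%N; split => //.
- exact: leq_trunc_div.
(* Since n %/ k >= 1, rounding the quotient down loses at most a factor 2. *)
- have n_le : n%:R <= 2 * ((n %/ k)%:R * (y * ell p n + 1)).
    apply: (@le_trans _ _ (2 * ((n %/ k)%:R * k%:R))); last first.
      by rewrite ler_wpM2l// ler_wpM2l// ltW.
    rewrite -natrM -natrM ler_nat.
    apply: leq_trans (ltnW (ltn_ceil n k0)) _.
    by rewrite mul2n -addnn mulSn leq_add2r leq_pmull// divn_gt0.
  rewrite en.
  have := ler_pM _ _ n_le pk_lo.
  set e := expR _ => /(_ (ler0n _ _)) h.
  have : 0 <= p * e by rewrite mulr_ge0 ?expR_ge0// ltW.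
  move/h; lra.
- rewrite en ler_pM// ?exprn_ge0 ?(ltW p_gt0)// ler_nat.
  exact: leq_div.
Unshelve. all: by end_near. Qed.

End RunTailMean.

(** * Large deviations from tail estimates *)

Section RunVaradhan.
Context (R : realType) (d : measure_display) (T : measurableType d).
Context (P : probability T R) (X : nat -> {RV P >-> R}).
Context (a : nat -> R) (a_pinfty : a @ \oo --> +oo).
Context (c b : R) (c_gt0 : 0 < c) (D : set R).
Local Notation W n phi := (scaled_mean (run_law X n) n (a n) phi).
Local Notation r := (fun x => c * (x - b)).
Context (D_ge0 : D `<=` [set x | 0 <= x]) (D_closed : closed D).
Context (D_nonempty : D !=set0).
Context (tail_upper : \forall n \near \oo, forall y,
  W n \1_[set z | y <= z] <= 2 * (1 + a n) * expR (- (c * (y - b) * a n))).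
Context (tail_lower : forall x, D x -> exists2 eta, 0 < eta &
  \forall n \near \oo, eta * expR (- (c * (x - b) * a n)) <=
    (1 + a n) * W n \1_[set z | x <= z]).
Context (off_domain : forall x k : R, 0 <= x -> ~ D x -> exists2 dl : R, 0 < dl &
  \forall n \near \oo, W n \1_(ball x dl) <= expR (- (k * a n))).

Let a_near_gt0 : \forall n \near \oo, 0 < a n.
Proof. by move/cvgryPgt: a_pinfty; exact. Qed.

Lemma tail_upper_rate y k : k < c * (y - b) ->
  \forall n \near \oo, W n \1_[set z | y <= z] <= expR (- (k * a n)).
Proof.
move=> ky; have kap : 0 < c * (y - b) - k by rewrite subr_gt0.
near=> n.
have an0 : 0 < a n by near: n.
have up : forall y, W n \1_[set z | y <= z] <=
  2 * (1 + a n) * expR (- (c * (y - b) * a n)) by near: n.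
have : 2 * (1 + a n) ^+ 2 * expR (- ((c * (y - b) - k) * a n)) <= 1.
  by near: n; exact: poly_expRN_le1.
set e := expR _ => h.
have -> : expR (- (k * a n)) = expR (- (c * (y - b) * a n)) * e^-1.
  by rewrite /e -expRN -expRD; congr expR; ring.
apply: le_trans (up y) _; rewrite mulrC ler_wpM2l ?expR_ge0//.
have e0 : 0 < e by exact: expR_gt0.
rewrite -[e^-1]mul1r ler_pdivlMr//.
apply: le_trans h; rewrite ler_wpM2r ?(ltW e0)//; nra.
Unshelve. all: by end_near. Qed.

Lemma run_local_upper (x k : R) : 0 <= x -> (D x -> k < r x) ->
  exists2 dl : R, 0 < dl &
    \forall n \near \oo, W n \1_(ball x dl) <= expR (- (k * a n)).
Proof.
move=> x0 h; have [Dx|nDx] := pselect (D x); last exact: off_domain.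
(* The radius lowers the rate at the left end x - dl by half the gap to k, and the ball lies in the
   tail from x - dl on. *)
have {h}kx := h Dx; pose dl := (c * (x - b) - k) / (2 * c).
have dl0 : 0 < dl by rewrite divr_gt0 ?mulr_gt0// subr_gt0.
exists dl => //.
have cdl : c * dl = (c * (x - b) - k) / 2 by rewrite /dl; field; rewrite lt0r_neq0.
have ky : k < c * ((x - dl) - b) by lra.
have up := tail_upper_rate ky.
near=> n; apply: (@le_trans _ _ (W n \1_[set z | x - dl <= z])); last by near: n.
apply: le_scaled_mean; first exact: run_law_ge0.
  by near: n.
move=> z z0; rewrite !indicE.
have [zb|] := boolP (z \in (ball x dl : set R)); last by move=> _; rewrite ler0n.
rewrite mem_set//=; move/set_mem: zb; rewrite /ball/= ltr_norml => /andP[]; lra.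
Unshelve. all: by end_near. Qed.

(** The ball carries at least the tail at x minus the tail at x + dl, and the latter is smaller by a
    factor exp(- c dl a n), up to polynomial factors. *)
Lemma run_local_lower x k dl : D x -> r x < k -> 0 < dl ->
  \forall n \near \oo, expR (- (k * a n)) <= W n \1_(ball x dl).
Proof.
move=> Dx xk dl0; have [eta eta0 low] := tail_lower Dx.
have k1 : 0 < k - c * (x - b) by rewrite subr_gt0.
have k2 : 0 < c * dl by rewrite mulr_gt0.
near=> n.
have an0 : 0 < a n by near: n.
have up : forall y, W n \1_[set z | y <= z] <=
  2 * (1 + a n) * expR (- (c * (y - b) * a n)) by near: n.
have low_n : eta * expR (- (c * (x - b) * a n)) <=
    (1 + a n) * W n \1_[set z | x <= z] by near: n.
(* The constants 2 / eta and 4 / eta make the target exp(- k a n) and the far tail, each multiplied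
   by 1 + a n, at most half of the lower bound for the tail at x. *)
have : 2 / eta * (1 + a n) ^+ 2 * expR (- ((k - c * (x - b)) * a n)) <= 1.
  by near: n; exact: poly_expRN_le1.
have : 4 / eta * (1 + a n) ^+ 2 * expR (- (c * dl * a n)) <= 1.
  by near: n; exact: poly_expRN_le1.
set e1 := expR _ => h1; set e2 := expR _ => h2.
have {}up := up (x + dl).
set E := expR _ in low_n.
have E0 : 0 < E by exact: expR_gt0.
have kE : expR (- (k * a n)) = E * e2.
  by rewrite /E /e2 -expRD; congr expR; ring.
have xE : expR (- (c * (x + dl - b) * a n)) = E * e1.
  by rewrite /E /e1 -expRD; congr expR; ring.
rewrite xE in up; rewrite kE.
have split_tail : W n \1_[set z | x <= z] <=
    W n \1_(ball x dl) + W n \1_[set z | x + dl <= z].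
  rewrite -scaled_meanD; apply: le_scaled_mean => //.
    exact: run_law_ge0.
  move=> z z0; rewrite !indicE.
  have [xz|zx] := leP x z; last first.
    by rewrite memNset ?addr_ge0//=; apply/negP; rewrite -ltNge.
  rewrite mem_set//.
  have [xdz|zxd] := leP (x + dl) z.
    by rewrite (@mem_set _ [set z | x + dl <= z])// lerDr.
  rewrite (@mem_set _ (ball x dl : set R)) ?lerDl// /ball/=.
  by rewrite ltr_norml; apply/andP; split; lra.
have s0 : 0 < 1 + a n by lra.
have h1' : 4 * (1 + a n) ^+ 2 * e1 <= eta.
  rewrite -[eta]mul1r -ler_pdivrMr//; apply: le_trans h1.
  by rewrite le_eqVlt; apply/orP; left; apply/eqP; field; rewrite lt0r_neq0.
have h2' : 2 * (1 + a n) ^+ 2 * e2 <= eta.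
  rewrite -[eta]mul1r -ler_pdivrMr//; apply: le_trans h2.
  by rewrite le_eqVlt; apply/orP; left; apply/eqP; field; rewrite lt0r_neq0.
rewrite -(ler_pM2l s0).
have e20 : 0 <= e2 by exact: expR_ge0.
have g2 : (1 + a n) * (E * e2) <= E * eta / 2.
  have : E * (2 * (1 + a n) ^+ 2 * e2) <= E * eta by rewrite ler_pM2l.
  have : 0 <= E * e2 * ((1 + a n) ^+ 2 - (1 + a n)).
    by rewrite mulr_ge0 ?mulr_ge0 ?(ltW E0)//; nra.
  lra.
have g1 : (1 + a n) * W n \1_[set z | x + dl <= z] <= E * eta / 2.
  have : (1 + a n) * W n \1_[set z | x + dl <= z] <=
    (1 + a n) * (2 * (1 + a n) * (E * e1)) by rewrite ler_pM2l.
  have : E * (4 * (1 + a n) ^+ 2 * e1) <= E * eta by rewrite ler_pM2l.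
  lra.
have : (1 + a n) * W n \1_[set z | x <= z] <=
  (1 + a n) * (W n \1_(ball x dl) + W n \1_[set z | x + dl <= z]) by rewrite ler_pM2l.
lra.
Unshelve. all: by end_near. Qed.

Lemma run_exp_tight (k : R) : exists K : R,
  \forall n \near \oo, W n \1_[set z | K < z] <= expR (- (k * a n)).
Proof.
pose K := b + (k + 1) / c; exists K.
have kK : k < c * (K - b) by rewrite /K addrC addKr mulrC divfK ?lt0r_neq0//; lra.
have up := tail_upper_rate kK.
near=> n; apply: (@le_trans _ _ (W n \1_[set z | K <= z])); last by near: n.
apply: le_scaled_mean; first exact: run_law_ge0.
  by near: n.
move=> z z0; rewrite !indicE.
have [/set_mem /= zb|] := boolP (z \in [set z | K < z]); last by move=> _; rewrite ler0n.
by rewrite mem_set//= ltW.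
Unshelve. all: by end_near. Qed.

Lemma run_rate_coercive (k : R) : exists K, forall x, D x -> K < x -> k <= r x.
Proof.
exists (b + k / c) => x _ Kx; rewrite -ler_pdivrMl// mulrC; lra.
Qed.

Lemma continuous_run_rate : continuous (r : R -> R).
Proof.
move=> x; apply: cvgM; first exact: cvg_cst.
by apply: cvgB; [exact: cvg_id|exact: cvg_cst].
Qed.

Section Moment.
Context (f : R -> R) (f_cont : {within [set x | 0 <= x], continuous f}).

Lemma tail_of_indicator :
  ((fun m : R => limn_esup (fun n => scaled_ln_mean P (a n)
      (fun w => expR (a n * f (run_length X n w / a n)) *
                \1_[set w' | m <= f (run_length X n w' / a n)] w)))
    @ +oo --> -oo%E) ->
  forall k : R, exists m : R, \forall n \near \oo,
    W n (fun z => expR (a n * f z) * \1_[set z' | m <= f z'] z)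
    <= expR (- (k * a n)).
Proof.
move=> + k => /cvgeNyPlt/(_ (- k)) h.
have [m hm] := filter_ex h; exists m.
have {}hm := limn_esup_lt hm.
near=> n; rewrite -mulNr.
have an0 : 0 < a n by near: n.
apply: (@scaled_ln_mean_le _ _ _ P (a n) an0 (fun w =>
    (fun z => expR (a n * f z) * \1_[set z' | m <= f z'] z)
      (run_length X n w / a n))).
  apply: expectation_run_length => z.
  by rewrite mulr_ge0 ?expR_ge0// indicE.
by apply: ltW; near: n.
Unshelve. all: by end_near. Qed.

Lemma tail_of_moment (gamma : R) : 1 < gamma ->
  (limn_esup (fun n => scaled_ln_mean P (a n)
     (fun w => expR (gamma * a n * f (run_length X n w / a n)%R))) < +oo)%E ->
  forall k : R, exists m : R, \forall n \near \oo,
    W n (fun z => expR (a n * f z) * \1_[set z' | m <= f z'] z)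
    <= expR (- (k * a n)).
Proof.
move=> gam1 hC k.
have [C {}hC] : exists C : R, (limn_esup (fun n => scaled_ln_mean P (a n)
     (fun w => expR (gamma * a n * f (run_length X n w / a n)%R))) < C%:E)%E.
  move: hC; case: limn_esup => [s _|//|_]; last by exists 0; exact: ltNyr.
  by exists (s + 1); rewrite lte_fin ltrDl.
(* Where m <= f, exp(a f) <= exp(- (gamma - 1) m a) exp(gamma a f). This m makes the first factor
   cancel the growth exp(C a) of the moment and leave exp(- k a). *)
exists ((C + k) / (gamma - 1)).
set m := (C + k) / (gamma - 1).
have mE : (gamma - 1) * m = C + k by rewrite mulrC divfK// subr_eq0 gt_eqF.
have {}hC := limn_esup_lt hC.
near=> n.
have an0 : 0 < a n by near: n.
have bound : W n (fun z => expR (gamma * a n * f z)) <= expR (C * a n).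
  apply: (@scaled_ln_mean_le _ _ _ P (a n) an0 (fun w =>
    (fun z => expR (gamma * a n * f z)) (run_length X n w / a n))).
    by apply: expectation_run_length => z; exact: expR_ge0.
  by apply: ltW; near: n.
apply: (@le_trans _ _ (W n (fun z =>
    expR (- ((gamma - 1) * m * a n)) * expR (gamma * a n * f z)))).
  apply: le_scaled_mean => //; first exact: run_law_ge0.
  move=> z z0; rewrite indicE.
  have [/set_mem /= mf|] := boolP (z \in [set z' | m <= f z']); last first.
    by move=> _; rewrite mulr0 mulr_ge0// expR_ge0.
  rewrite mulr1 -expRD ler_expR.
  have : 0 <= (gamma - 1) * (a n * (f z - m)).
    by rewrite mulr_ge0 ?subr_ge0 ?(ltW gam1)// mulr_ge0 ?(ltW an0)// subr_ge0.
  lra.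
rewrite scaled_meanZ; apply: le_trans (ler_wpM2l (expR_ge0 _) bound) _.
by rewrite -expRD ler_expR mE; lra.
Unshelve. all: by end_near. Qed.

Lemma run_varadhan (I : R -> \bar R) :
  (forall x, D x -> I x = (c * (x - b))%:E) ->
  (forall x, ~ D x -> I x = +oo%E) ->
  ((fun m : R => limn_esup (fun n => scaled_ln_mean P (a n)
      (fun w => expR (a n * f (run_length X n w / a n)) *
                \1_[set w' | m <= f (run_length X n w' / a n)] w)))
    @ +oo --> -oo%E)
  \/
  (exists2 gamma : R, 1 < gamma &
     (limn_esup (fun n => scaled_ln_mean P (a n)
        (fun w => expR (gamma * a n * f (run_length X n w / a n)%R)))
      < +oo)%E) ->
  exists2 M : \bar R, is_maximum (range (rate_gap f I)) M &
    (fun n => scaled_ln_mean P (a n)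
       (fun w => expR (a n * f (run_length X n w / a n)))) @ \oo --> M.
Proof.
move=> ID InD ab.
have f_tail : forall k : R, exists m : R, \forall n \near \oo,
    W n (fun z => expR (a n * f z) * \1_[set z' | m <= f z'] z)
    <= expR (- (k * a n)).
  by case: ab => [|[gamma]]; [exact: tail_of_indicator|exact: tail_of_moment].
have q0 := run_law_ge0 X.
have [x Dx xmax] := varadhan_max q0 a_pinfty D_ge0 D_closed D_nonempty
  continuous_run_rate f_cont run_rate_coercive run_local_lower f_tail.
pose M := f x - c * (x - b).
exists M%:E.
  split; first by exists x => //; rewrite /rate_gap ID.
  move=> _ [y _ <-]; rewrite /rate_gap.
  have [Dy|nDy] := pselect (D y).
    by rewrite ID// -EFinB lee_fin; exact: xmax.
  by rewrite InD// addeNy leNye.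
have low e : 0 < e -> \forall n \near \oo,
    expR ((M - e) * a n) <= W n (fun z => expR (a n * f z)).
  move=> e0; have Me : M - e < f x - c * (x - b) by rewrite /M; lra.
  have fx : f x - 1 < f x by lra.
  have lo := varadhan_lower q0 a_pinfty D_ge0 f_cont run_local_lower Dx Me fx.
  near=> n; apply: (@le_trans _ _ (W n (fun z =>
    expR (a n * f z) * \1_[set z' | f x - 1 <= f z'] z))); first by near: n.
  apply: le_scaled_mean; [exact: run_law_ge0|by near: n|].
  by move=> z z0; rewrite ler_piMr ?expR_ge0// indicE lern1; case: (_ \in _).
(* Positivity makes the extended logarithm a real one, so the limit can be taken in the reals. *)
have W_gt0 : \forall n \near \oo, 0 < W n (fun z => expR (a n * f z)).
  near=> n; apply: lt_le_trans (expR_gt0 ((M - 1) * a n)) _.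
  by near: n; exact: low.
apply: (@cvg_trans _
    ((fun n => (ln (W n (fun z => expR (a n * f z))) / a n)%:E) @ \oo)).
  apply: near_eq_cvg; near=> n.
  apply/esym/(@scaled_ln_meanE _ _ _ P (a n)); last by near: n.
  by apply: expectation_run_length => z; exact: expR_ge0.
apply: cvg_EFin; first exact: nearW.
apply/cvgrPdist_le => e e0; near=> n => /=.
have an0 : 0 < a n by near: n.
have Wn0 : 0 < W n (fun z => expR (a n * f z)) by near: n.
have lo : expR ((M - e) * a n) <= W n (fun z => expR (a n * f z)).
  by near: n; exact: low.
have up : W n (fun z => expR (a n * f z)) <= expR ((M + e) * a n).
  near: n; exact: (varadhan_upper q0 a_pinfty f_cont run_local_upper
    run_exp_tight f_tail xmax e0).
rewrite distrC ler_distl ler_pdivlMr// ler_pdivrMr//.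
by rewrite -ler_expR -[X in _ && X]ler_expR lnK ?posrE// lo.
Unshelve. all: by end_near. Qed.

End Moment.
End RunVaradhan.

(** * The two scalings *)

Section Speeds.
Context (R : realType) (d : measure_display) (T : measurableType d).
Context (P : probability T R) (p : R) (X : nat -> {RV P >-> R}).
Context (p_gt0 : 0 < p) (p_lt1 : p < 1) (X_iid : iid_bernoulli p X).
Local Notation W n a phi := (scaled_mean (run_law X n) n a phi).
Local Notation c := (ln p^-1).

Let p01 k : 0 <= p ^+ k <= 1.
Proof. by rewrite exprn_ge0 ?exprn_ile1// ltW. Qed.

(** The n + 1 starting points of the union bound number at most 2 n = 2 exp(c ell(n)), which shifts
    the rate from c y to c (y - 1). *)
Lemma log_tail_upper : \forall n \near \oo, forall y,
  W n (ell p n) \1_[set z | y <= z] <=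
  2 * (1 + ell p n) * expR (- (c * (y - 1) * ell p n)).
Proof.
near=> n => y.
have n0 : (0 < n)%N by near: n; exists 1%N.
have a0 : 0 < ell p n by near: n; move/cvgryPgt: (ell_pinfty p_gt0 p_lt1); exact.
apply: le_trans (mean_tail_le p_gt0 p_lt1 X_iid n y a0) _.
have -> : expR (- (c * (y - 1) * ell p n)) = n%:R * expR (- (c * y * ell p n)).
  by rewrite -(expR_ell p_gt0 p_lt1 n0) -expRD; congr expR; ring.
rewrite mulrA ler_wpM2r ?expR_ge0// -natr1.
have : 1 <= n%:R :> R by rewrite ler1n.
nra.
Unshelve. all: by end_near. Qed.

Lemma log_tail_lower x : 1 <= x -> exists2 eta, 0 < eta &
  \forall n \near \oo, eta * expR (- (c * (x - 1) * ell p n)) <=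
    (1 + ell p n) * W n (ell p n) \1_[set z | x <= z].
Proof.
(* p / 2 comes from [many_blocks], another 1/2 from the bound u / 2 below, and x + 1 from x ell(n) +
   1 <= (x + 1) (1 + ell(n)). *)
move=> x1; exists (p / (4 * (x + 1))).
  by rewrite divr_gt0// mulr_gt0//; lra.
have x0 : 0 < x by lra.
have blocks := many_blocks p_gt0 p_lt1 x0.
near=> n.
have a0 : 0 < ell p n by near: n; move/cvgryPgt: (ell_pinfty p_gt0 p_lt1); exact.
have [k [m [hk mk lo up]]] : exists k m : nat,
    [/\ forall l : nat, (x * ell p n <= l%:R) = (k <= l)%N,
        (m * k <= n)%N,
        p / 2 * expR (c * (1 - x) * ell p n) <=
          m%:R * p ^+ k * (x * ell p n + 1) &
        m%:R * p ^+ k <= expR (c * (1 - x) * ell p n)] by near: n.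
have := mean_tail_ge X_iid a0 mk hk.
have := pow_mul_le1 m (p01 k).
have E1 : expR (c * (1 - x) * ell p n) <= 1.
  have c0 := ln_invp_gt0 p_gt0 p_lt1.
  rewrite expR_le1.
  have : 0 <= c * (x - 1) * ell p n 
    by rewrite mulr_ge0 ?(ltW a0)// mulr_ge0 ?(ltW c0)// subr_ge0.
  lra.
have -> : - (c * (x - 1) * ell p n) = c * (1 - x) * ell p n by ring.
move: lo up E1; set E := expR _; set u := m%:R * p ^+ k.
set v := (1 - _) ^+ m; set w := scaled_mean _ _ _ _ => lo up E1 vu vw.
have u0 : 0 <= u by rewrite mulr_ge0// exprn_ge0// ltW.
have u1 : u <= 1 by exact: le_trans up E1.
(* As x >= 1, the expected number u of full blocks is at most 1. Then (1 - u/2)(1 + u) = 1 + u (1 -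
   u)/2 >= 1 >= v (1 + u). *)
have v_le : v <= 1 - u / 2.
  rewrite leNgt; apply/negP => hv.
  have : (1 - u / 2) * (1 + u) < v * (1 + u) by rewrite ltr_pM2r//; lra.
  have : 0 <= u * (1 - u) by rewrite mulr_ge0// subr_ge0.
  lra.
have uw : u / 2 <= w by lra.
have s1 : u * (x * ell p n + 1) <= u * ((x + 1) * (1 + ell p n)).
  by rewrite ler_wpM2l//; nra.
rewrite mulrAC ler_pdivrMr; last by lra.
have s2 : (1 + ell p n) * (u / 2) * (x + 1) <= (1 + ell p n) * w * (x + 1).
  by rewrite ler_wpM2r ?ler_wpM2l//; lra.
lra.
Unshelve. all: by end_near. Qed.

(** Below 1 the expected number u of full blocks grows exponentially in ell(n), and no block is full
    with probability at most exp(- u), which beats exp(- k ell(n)) for every k. *)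
Lemma log_off_domain (x k : R) : 0 <= x -> ~ 1 <= x -> exists2 dl : R, 0 < dl &
  \forall n \near \oo,
    W n (ell p n) \1_(ball x dl) <= expR (- (k * ell p n)).
Proof.
move=> x0 /negP; rewrite -ltNge => x1; pose y := (1 + x) / 2.
have y0 : 0 < y by rewrite /y; lra.
have c0 := ln_invp_gt0 p_gt0 p_lt1.
have k0 : 0 < c * (1 - y) by rewrite mulr_gt0// /y; lra.
have blocks := many_blocks p_gt0 p_lt1 y0.
(* One power of 1 + ell(n) pays for the block length in [many_blocks]; the other leaves |k| (1 +
   ell(n)) <= u. *)
have small := poly_expRN_le1 (2 * `|k| / p) (ell_pinfty p_gt0 p_lt1) k0.
exists ((1 - x) / 2); first by lra.
near=> n.
have a0 : 0 < ell p n by near: n; move/cvgryPgt: (ell_pinfty p_gt0 p_lt1); exact.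
have [j [m [hj mj lo _]]] : exists j m : nat,
    [/\ forall l : nat, (y * ell p n <= l%:R) = (j <= l)%N,
        (m * j <= n)%N,
        p / 2 * expR (c * (1 - y) * ell p n) <=
          m%:R * p ^+ j * (y * ell p n + 1) &
        m%:R * p ^+ j <= expR (c * (1 - y) * ell p n)] by near: n.
apply: (@le_trans _ _ (W n (ell p n) \1_[set z | z < y])).
  apply: le_scaled_mean => //; first exact: run_law_ge0.
  move=> z z0; rewrite !indicE.
  have [/set_mem zb|] := boolP (z \in (ball x ((1 - x) / 2) : set R)); last first.
    by move=> _; rewrite ler0n.
  rewrite mem_set//=; move: zb; rewrite /ball/= ltr_norml /y => /andP[]; lra.
apply: le_trans (mean_below_le X_iid a0 mj hj) _.
apply: le_trans (pow_le_expR m (p01 j)) _.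
rewrite ler_expR lerN2.
have : 2 * `|k| / p * (1 + ell p n) ^+ 2 * expR (- (c * (1 - y) * ell p n)) <= 1.
  by near: n.
rewrite expRN ler_pdivrMr ?expR_gt0// mul1r => big.
have {}big : `|k| * (1 + ell p n) ^+ 2 <= p / 2 * expR (c * (1 - y) * ell p n).
  have -> : `|k| * (1 + ell p n) ^+ 2 = p / 2 * (2 * `|k| / p * (1 + ell p n) ^+ 2).
    by field; rewrite lt0r_neq0.
  by rewrite ler_wpM2l// divr_ge0// ltW.
move: lo big; set u := m%:R * p ^+ j; set E := expR _ => lo big.
have u0 : 0 <= u by rewrite mulr_ge0// exprn_ge0// ltW.
have : u * (y * ell p n + 1) <= u * (1 + ell p n).
  by rewrite ler_wpM2l// /y; nra.
have kk := ler_norm k.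
move=> h; have : `|k| * (1 + ell p n) <= u.
  rewrite -(@ler_pM2r _ (1 + ell p n)); last by lra.
  apply: le_trans (le_trans big (le_trans lo h)).
  by rewrite expr2 mulrA.
have : k * ell p n <= `|k| * ell p n by rewrite ler_wpM2r// ltW.
have := normr_ge0 k; lra.
Unshelve. all: by end_near. Qed.

Lemma linear_tail_upper : \forall n \near \oo, forall y,
  W n n%:R \1_[set z | y <= z] <=
  2 * (1 + n%:R) * expR (- (c * (y - 0) * n%:R)).
Proof.
near=> n => y; rewrite subr0.
have n0 : 0 < n%:R :> R by rewrite ltr0n; near: n; exists 1%N.
apply: le_trans (mean_tail_le p_gt0 p_lt1 X_iid n y n0) _.
by rewrite ler_wpM2r ?expR_ge0// -natr1; lra.
Unshelve. all: by end_near. Qed.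

(** A single block of length k, the ceiling of x n, suffices: it fits because x <= 1, it is full
    with probability p^k, and rounding up costs the factor eta = p. *)
Lemma linear_tail_lower x : 0 <= x <= 1 -> exists2 eta, 0 < eta &
  \forall n \near \oo, eta * expR (- (c * (x - 0) * n%:R)) <=
    (1 + n%:R) * W n n%:R \1_[set z | x <= z].
Proof.
move=> /andP[x0 x1]; exists p => //; near=> n; rewrite subr0.
have n0 : 0 < n%:R :> R by rewrite ltr0n; near: n; exists 1%N.
have c0 := ln_invp_gt0 p_gt0 p_lt1.
have [k [hk ku]] := nat_ceil (x * n%:R).
have {ku}k_lt : k%:R < x * n%:R + 1 by apply: ku; rewrite mulr_ge0// ltW.
have kn : (1 * k <= n)%N by rewrite mul1n -hk ler_piMl// ltW.
have := mean_tail_ge X_iid n0 kn hk.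
rewrite expr1 opprB addrCA subrr addr0.
set w := scaled_mean _ _ _ _ => pw.
have pk : p * expR (- (c * x * n%:R)) <= p ^+ k.
  rewrite -[X in X * _]expr1 !(expr_p_expR p_gt0) -expRD ler_expR; nra.
have : 0 <= p ^+ k by rewrite exprn_ge0// ltW.
nra.
Unshelve. all: by end_near. Qed.

Lemma linear_off_domain (x k : R) : 0 <= x -> ~ (0 <= x <= 1) ->
  exists2 dl : R, 0 < dl &
    \forall n \near \oo, W n n%:R \1_(ball x dl) <= expR (- (k * n%:R)).
Proof.
move=> x0; rewrite x0 /= => /negP; rewrite -ltNge => x1.
(* The ball stays to the right of 1, while L(n) / n <= 1, so its mass is zero. *)
exists (x - 1); first by rewrite subr_gt0.
near=> n.
have n0 : 0 < n%:R :> R by rewrite ltr0n; near: n; exists 1%N.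
rewrite /scaled_mean big1 ?expR_ge0// => i _.
rewrite indicE memNset ?mul0r// /ball/= ltr_norml => /andP[_].
have : i%:R / n%:R <= 1 :> R.
  by rewrite ler_pdivrMr// mul1r ler_nat -ltnS ltn_ord.
lra.
Unshelve. all: by end_near. Qed.

End Speeds.

Theorem corollary3 (R : realType) (d : measure_display) (T : measurableType d)
    (P : probability T R) (p : R) (X : nat -> {RV P >-> R})
    (p_gt0 : 0 < p) (p_lt1 : p < 1) (X_iid : iid_bernoulli p X) :
  (forall f : R -> R,
     {within [set x | 0 <= x], continuous f} ->
     ((fun m : R => limn_esup (fun n => scaled_ln_mean P (ell p n)
         (fun w => expR (ell p n * f (run_length X n w / ell p n)) *
                   \1_[set w' | m <= f (run_length X n w' / ell p n)] w)))
        @ +oo --> -oo%E)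
     \/
     (exists2 gamma : R, 1 < gamma &
        (limn_esup (fun n => scaled_ln_mean P (ell p n)
           (fun w => expR (gamma * ell p n *
                           f (run_length X n w / ell p n)%R)))
         < +oo)%E) ->
     exists2 M : \bar R, is_maximum (range (rate_gap f (rate p))) M &
       (fun n => scaled_ln_mean P (ell p n)
          (fun w => expR (ell p n * f (run_length X n w / ell p n))))
         @ \oo --> M)
  /\
  (forall g : R -> R,
     {within [set x | 0 <= x], continuous g} ->
     ((fun m : R => limn_esup (fun n => scaled_ln_mean P n%:R
         (fun w => expR (n%:R * g (run_length X n w / n%:R)) *
                   \1_[set w' | m <= g (run_length X n w' / n%:R)] w)))
        @ +oo --> -oo%E)
     \/
     (exists2 gamma : R, 1 < gamma &
        (limn_esup (fun n => scaled_ln_mean P n%:R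
           (fun w => expR (gamma * n%:R * g (run_length X n w / n%:R)%R)))
         < +oo)%E) ->
     exists2 M : \bar R, is_maximum (range (rate_gap g (rate_tilde p))) M &
       (fun n => scaled_ln_mean P n%:R
          (fun w => expR (n%:R * g (run_length X n w / n%:R))))
         @ \oo --> M).
Proof.
have c0 := ln_invp_gt0 p_gt0 p_lt1.
split=> f f_cont.
- apply: (run_varadhan (ell_pinfty p_gt0 p_lt1) c0 (D := [set x | 1 <= x])
    (b := 1)) => //.
  + by move=> x; exact: le_trans.
  + by exists 1 => /=.
  + exact: log_tail_upper.
  + exact: log_tail_lower.
  + exact: log_off_domain.
  + by move=> x /= x1; rewrite /rate ltNge x1/= mulrC.
  + by move=> x /= /negP; rewrite -ltNge /rate => ->.
- apply: (run_varadhan (@cvgr_idn R) c0 (D := [set x | 0 <= x <= 1])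
    (b := 0)) => //.
  + by move=> x /= /andP[].
  + rewrite (_ : [set _ | _] = `[0, 1]%classic); first exact: itv_closed.
    by apply/seteqP; split=> x; rewrite /= in_itv.
  + by exists 0; rewrite /= lexx ler01.
  + exact: linear_tail_upper.
  + exact: linear_tail_lower.
  + exact: linear_off_domain.
  + by move=> x /= x01; rewrite /rate_tilde x01 subr0 mulrC.
  + by move=> x /= /negP/negbTE; rewrite /rate_tilde => ->.
Qed.
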